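(* Let $n$ be either of the form $n=p^k$ with $p$ an odd prime and $k\geq 1$, or of the form $n=p^kq^{\ell}$ with $p<q$ odd primes and $k,\ell\geq 1$. Let $D_n$ be the dihedral group of order $2n$, let $s\in D_n$ be a reflection and $r\in D_n$ a rotation of order $n$. Then the Cayley graph of $D_n$ with respect to the generating set $\{r,s\}$ is a Černý Cayley graph.
   Context: For a finite set $X$, $T_X$ is the set of all maps $X\to X$, acting on the right of $X$. An automaton with state set $X$ is a subset $\Sigma\subseteq T_X$, written $(X,\Sigma)$. The free monoid $\Sigma^*$ acts on the right of $X$ via the homomorphism $\Sigma^*\to T_X$ extending the inclusion $\Sigma\hookrightarrow T_X$. A word $w\in\Sigma^*$ is synchronizing if $|Xw|=1$; the automaton is synchronizing if it admits a synchronizing word. If $G$ is a finite group with generating set $\Delta$, elements of $\Delta$ are identified with the right translations $g\mapsto gd$ of $G$, so $\Delta\subseteq T_G$; the automaton $(G,\Delta)$ is the Cayley graph of $G$ with respect to $\Delta$. $(G,\Delta)$ is a Černý Cayley graph if every synchronizing automaton $(G,\Sigma)$ with $\Delta\subseteq\Sigma\subseteq T_G$ admits a synchronizing word of length at most $(|G|-1)^2$. *)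

(* Defs.v *)
From mathcomp Require Import all_boot all_fingroup all_solvable.

Set Implicit Arguments.
Unset Strict Implicit.
Unset Printing Implicit Defensive.

Local Open Scope group_scope.

(* An automaton with state set X is a set Sigma : {set {ffun X -> X}} of maps
   acting on the right of X; a word over Sigma is a sequence of elements of
   Sigma. *)
Section Automata.

Variable X : finType.
Implicit Types (w : seq {ffun X -> X}) (Sigma : {set {ffun X -> X}}).

(* x w for w = f1 f2 ... fm: the leftmost letter f1 acts first. *)
Definition word_act (x : X) w : X := foldl (fun y (f : {ffun X -> X}) => f y) x w.

Definition word_over Sigma w : Prop := {subset w <= Sigma}.

Definition synchronizing_word w : Prop := #|[set word_act x w | x : X]| = 1%N.

Definition synchronizing Sigma : Prop :=
  exists2 w, word_over Sigma w & synchronizing_word w.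

End Automata.

Section CayleyGraph.

Variable gT : finGroupType.

Definition right_translation (d : gT) : {ffun gT -> gT} := [ffun g => g * d].

Definition cayley_automaton (Delta : {set gT}) : {set {ffun gT -> gT}} :=
  [set right_translation d | d in Delta].

(* The Cayley graph is only considered for a generating set Delta. *)
Definition cerny_cayley_graph (Delta : {set gT}) : Prop :=
  <<Delta>> = [set: gT] /\
  forall Sigma : {set {ffun gT -> gT}},
    cayley_automaton Delta \subset Sigma -> synchronizing Sigma ->
    exists w, [/\ word_over Sigma w, synchronizing_word w
                & (size w <= (#|gT| - 1) ^ 2)%N].

End CayleyGraph.

(* 'D_(n.*2) is the dihedral group of order 2n.  For n >= 3 it has exactly one
   cyclic subgroup of order n, and this is the subgroup of rotations; the
   definitions below are only meaningful in that range. *)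
Definition is_rotation n (x : 'D_(n.*2)) : Prop :=
  exists C : {group 'D_(n.*2)}, [/\ cyclic C, #|C| = n & x \in C].

Definition is_reflection n (x : 'D_(n.*2)) : Prop := ~ is_rotation x.

(* Main.v *)
Require Import Defs.
From HB Require Import structures.
From mathcomp Require Import all_boot all_fingroup all_solvable.
From mathcomp Require Import all_order all_algebra all_field.
From mathcomp Require Import zify.

(** The idea is to let the words over Sigma act on the space of rational
functions on the group, and to count dimensions.

Fix a group G of order N, a proper nonempty subset S, and let gamma be the
indicator function of S minus its mean.  Pulling gamma back along a word w and
summing the values gives the gain |w^-1 S| - |S|, so a word that expands S is
one for which this sum is positive.  The sum is a linear functional; call its
kernel the space of balanced functions.  The average over g in G of the
translates of a balanced function is zero, hence as soon as u g w gamma is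
unbalanced for some g while w gamma is balanced, some g' in G makes the sum of
u g' w gamma positive (average_balanced).  Thus an expanding word is found from
an unbalanced function at the price of one group element, that is of d extra
letters if every group element is a word of length at most d in the generators.

Unbalanced functions are reached by the usual ascending chain argument
(grow_escape): applying letters to a subspace increases its dimension until the
balanced space, of dimension N - 1, is left.  The gain over the trivial bound
comes from an element r of G.  The operator of translation by r is a root of
X^#[r] - 1, which has over the rationals an irreducible factor of degree
phi = totient #[r], the cyclotomic polynomial.  Let psi be the value of the
complementary factor at this operator.  Every subspace stable under r and not
killed by psi has an image under psi of dimension at least phi
(cyclotomic_projection).  Let j be the first step at which the span U of the
functions w gamma, with w of length at most j, leaves the balanced part of
ker psi; until then the dimension grows at each step.  If U still consists of
balanced functions, the span X of its G-translates has dimension at least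
j + phi, and the balanced space is left after at most N - j - phi further
letters.  With the price d for the group element, S is expanded by a word of
length at most
  (N - j - phi) + d + j = N - phi + d <= N,
whenever d <= phi (expanding_word).  If U contains an unbalanced function, then
S is expanded by a word of length at most j + d, and j <= dim ker psi <= N - phi
gives the same bound.  Starting with a letter that merges two
points, N - 2 expansions give a synchronizing word of length at most
1 + (N - 2) N = (N - 1)^2 (cerny_of_diameter_le_totient).

In the dihedral group with n odd, every element is a word of length at most
(n + 1) / 2 in r and s (dihedral_diameter), and for the values of n considered
totient n is at least (n + 1) / 2 (half_le_totient): its quotient by n is at
least 2/3 for a prime power and 2/3 * 4/5 = 8/15 with two primes, where
moreover n >= 15. *)

Set Implicit Arguments.
Unset Strict Implicit.
Unset Printing Implicit Defensive.
Import Order.TTheory GRing.Theory Num.Theory.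

(** * Endomorphisms annihilated by an irreducible polynomial *)

Section LfunHorner.
Local Open Scope ring_scope.
Variables (K : fieldType) (V : vectType K) (T : 'End(V)).
Hypothesis V_proper : (0 < dim V)%N.

(** The endomorphisms of [V] form a nontrivial algebra only when [V] is nonzero,
whence the dependence on [V_proper]. *)
Definition lfun_horner (p : {poly K}) : 'End(V) :=
  @horner_alg K (lfun_algType V_proper) T p.

Lemma lfun_hornerM p q v :
  lfun_horner (p * q) v = lfun_horner p (lfun_horner q v).
Proof. by rewrite mulrC /lfun_horner rmorphM /= comp_lfunE. Qed.

Lemma lfun_hornerD p q v :
  lfun_horner (p + q) v = lfun_horner p v + lfun_horner q v.
Proof. by rewrite /lfun_horner rmorphD /= add_lfunE. Qed.

Lemma lfun_horner1 v : lfun_horner 1 v = v.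
Proof. by rewrite /lfun_horner rmorph1 /= id_lfunE. Qed.

Lemma lfun_horner0 v : lfun_horner 0 v = 0.
Proof. by rewrite /lfun_horner rmorph0 zero_lfunE. Qed.

Lemma lfun_hornerX v : lfun_horner 'X v = T v.
Proof. by rewrite /lfun_horner horner_algX. Qed.

Lemma lfun_hornerZ c p v : lfun_horner (c *: p) v = c *: lfun_horner p v.
Proof.
rewrite -mul_polyC lfun_hornerM /lfun_horner horner_algC.
by rewrite scale_lfunE id_lfunE.
Qed.

Lemma lfun_hornerXn n v : lfun_horner 'X^n v = iter n T v.
Proof.
elim: n => [|n IHn]; first by rewrite expr0 lfun_horner1.
by rewrite exprS lfun_hornerM lfun_hornerX IHn.
Qed.

Lemma lfun_horner_comm p v : T (lfun_horner p v) = lfun_horner p (T v).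
Proof. by rewrite -!lfun_hornerX -!lfun_hornerM mulrC. Qed.

Lemma lfun_horner_XnsubC n v : lfun_horner ('X^n - 1) v = iter n T v - v.
Proof.
rewrite lfun_hornerD lfun_hornerXn; congr (_ + _).
by rewrite /lfun_horner rmorphN rmorph1 /= opp_lfunE id_lfunE.
Qed.

Lemma lfun_horner_sum n (E : 'I_n -> K) v :
  lfun_horner (\sum_(i < n) E i *: 'X^i) v = \sum_(i < n) E i *: iter i T v.
Proof.
elim: n E => [|n IHn] E; first by rewrite !big_ord0 lfun_horner0.
by rewrite !big_ord_recr lfun_hornerD IHn lfun_hornerZ lfun_hornerXn.
Qed.

(** For a nonzero [x] in [X], the vectors [x], [T x], ... up to exponent
[deg p - 1] are linearly independent: a relation between them is a polynomial
[q] of degree less than [deg p] with [q(T) x = 0]; it is coprime to [p] by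
irreducibility, and a Bezout relation then gives [x = 0]. *)
Lemma dim_irreducible_annihilated (p : {poly K}) (X : {vspace V}) :
    irreducible_poly p -> (T @: X <= X)%VS -> X != 0%VS ->
    {in X, forall v, lfun_horner p v = 0} ->
  ((size p).-1 <= \dim X)%N.
Proof.
move=> [p_gt1 irr_p] TX nzX pX; set x := vpick X.
have nzx: x != 0 by rewrite vpick0.
have Xx i: iter i T x \in X.
  elim: i => [|i IHi]; first exact: memv_pick.
  by apply: subvP TX _ _; apply: memv_img.
pose B := [tuple iter i T x | i < (size p).-1].
have freeB: free B.
  apply/freeP=> k sum0 i.
  pose q := \poly_(j < (size p).-1) (if insub j is Some j' then k j' else 0).
  have q_def: q = \sum_(j < (size p).-1) k j *: 'X^j.
    by rewrite /q poly_def; apply: eq_bigr => j _; rewrite valK.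
  have qx: lfun_horner q x = 0.
    rewrite q_def lfun_horner_sum -[RHS]sum0; apply: eq_bigr => j _.
    by rewrite (nth_mktuple (fun j : 'I_ _ => iter j T x)).
  suffices q0: q = 0.
    by move/polyP/(_ i): q0; rewrite coef_poly ltn_ord valK coef0.
  apply/eqP/negPn/negP=> nzq; case/negP: nzx.
  have cop: coprimep p q.
    rewrite /coprimep; apply: contraT => g_n1.
    have /eqp_size sz_p := irr_p _ g_n1 (dvdp_gcdl p q).
    have := leq_trans (dvdp_leq nzq (dvdp_gcdr p q)) (size_poly _ _).
    by rewrite sz_p -ltnS prednK ?ltnn // ltnW.
  have [[a b] /= /eqpP] := Bezout_coprimepP _ _ cop.
  case=> [[c d]] /= /andP[nzc nzd] E.
  have: lfun_horner (d%:A) x = 0.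
    rewrite -E lfun_hornerZ lfun_hornerD !lfun_hornerM qx pX.
      by rewrite !linear0 addr0 scaler0.
    exact: Xx 0%N.
  by move/eqP; rewrite lfun_hornerZ lfun_horner1 scaler_eq0 (negPf nzd).
have <- : \dim <<B>> = (size p).-1 by rewrite (eqnP freeB) size_tuple.
apply: dimvS; apply/span_subvP=> _ /codomP[i ->] /=; exact: Xx.
Qed.

End LfunHorner.

Section RationalCyclotomic.
Local Open Scope ring_scope.

(** The factor is the minimal polynomial over the rationals of a primitive
[n]-th root of unity. *)
Lemma rat_cyclotomic_factor n : (0 < n)%N ->
  exists p : {poly rat}, [/\ irreducible_poly p, size p = (totient n).+1
                           & p %| 'X^n - 1].
Proof.
move=> n_gt0; have [z prim_z] := C_prim_root_exists n_gt0.
have [p [Dp mon_p] dv_p] := minCpolyP z.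
have sz_p: size p = (totient n).+1.
  rewrite -(size_cyclotomic z) -(minCpoly_cyclotomic prim_z) Dp.
  by rewrite size_map_poly.
exists p; split=> //; last first.
  rewrite -dv_p rmorphB rmorph1 /= map_polyXn /root !hornerE.
  by rewrite prim_expr_order // subrr.
split=> [|q q_n1 /dvdpP[u Du]]; first by rewrite sz_p ltnS totient_gt0.
have nzp := monic_neq0 mon_p.
have [nzu nzq]: u != 0 /\ q != 0 by apply/andP; rewrite -negb_or -mulf_eq0 -Du.
have : root (map_poly ratr (u * q)) z by rewrite dv_p -Du.
rewrite rmorphM rootM !dv_p => /orP[/(dvdp_leq nzu)|] p_dv; last first.
  by rewrite /eqp p_dv Du dvdp_mull.
case/negP: q_n1; move: p_dv; rewrite Du size_mul //.
move: nzq nzu; rewrite -!size_poly_gt0; case: (size q) => [|[|s]] // _.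
by case: (size u) => // t _; rewrite addnS /= -[leqRHS]addn0 leq_add2l.
Qed.

End RationalCyclotomic.

(** * Chains of subspaces grown by letters *)

Section Growth.
Local Open Scope ring_scope.
Variables (K : fieldType) (V : vectType K) (I : finType) (A : {set I}).
Variable T : I -> 'End(V).
Implicit Types (w : seq I) (W Y : {vspace V}).

(** The last letter of [w] acts first, as for pullback of functions along the
right action of words. *)
Definition word_lfun w : 'End(V) := foldr (fun a f => T a \o f)%VF \1%VF w.

Lemma word_lfun_cat u w : word_lfun (u ++ w) = (word_lfun u \o word_lfun w)%VF.
Proof. by elim: u => [|a u IHu] /=; rewrite ?comp_lfun1l // IHu comp_lfunA. Qed.

Definition grow W : {vspace V} := (W + \sum_(a in A) T a @: W)%VS.

Lemma sub_grow W : (W <= grow W)%VS. Proof. exact: addvSl. Qed.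

Lemma sub_iter_grow i j W : (i <= j)%N -> (iter i grow W <= iter j grow W)%VS.
Proof.
move/subnK<-; elim: (j - i)%N => //= k IHk.
exact: subv_trans IHk (sub_grow _).
Qed.

(** The [j]-th term of the chain is the span of the images of [W] under the
words of length at most [j]. *)
Lemma iter_grow_subP j W Y :
  reflect (forall w, {subset w <= A} -> (size w <= j)%N ->
             (word_lfun w @: W <= Y)%VS)
          (iter j grow W <= Y)%VS.
Proof.
apply: (iffP idP) => [sWY w Aw sz_w | ].
  apply: subv_trans (subv_trans (sub_iter_grow W sz_w) sWY) => {j Y sWY sz_w}.
  elim: w Aw => [|a w IHw] Aw /=; first by rewrite lim1g.
  rewrite limg_comp; apply: subv_trans (addvSr _ _).
  apply: (sumv_sup a); first by apply: Aw; rewrite mem_head.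
  by apply/limgS/IHw => b wb; apply: Aw; rewrite inE wb orbT.
elim: j W => [|j IHj] W sWY; first by have := sWY [::]; rewrite /= lim1g; apply.
rewrite iterSr; apply: IHj => w Aw sz_w; rewrite limgD subv_add.
rewrite sWY ?(leq_trans sz_w) //= limg_sum; apply/subv_sumP => a Aa.
have := sWY (w ++ [:: a]); rewrite word_lfun_cat /= comp_lfun1r limg_comp.
apply; last by rewrite size_cat addn1.
by move=> b; rewrite mem_cat inE => /orP[/Aw | /eqP->].
Qed.


(** Let [j] be the first step at which the chain leaves [Y].  Before it the
dimension increases at each step, since a stationary chain would never leave
[Y], and the term of index [j - 1] lies in the intersection of the conclusion.
The hypothesis on dimensions covers [j = 0]; it holds both for [W] included in
[Y] and for a line [W]. *)
Lemma grow_escape W Y :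
    (\dim W <= (\dim (W :&: Y)).+1)%N ->
    (exists2 w, {subset w <= A} & ~~ (word_lfun w @: W <= Y)%VS) ->
  exists2 j, ~~ (iter j grow W <= Y)%VS
    & (\dim W + j <= (\dim (iter j grow W :&: Y)).+1)%N.
Proof.
move=> dimW [w0 Aw0 w0WY].
have ex_j: exists j, ~~ (iter j grow W <= Y)%VS.
  by exists (size w0); apply: contra w0WY => /iter_grow_subP->.
case: (ex_minnP ex_j) => j nsUY min_j; exists j => //.
case: j => [|j] in nsUY min_j *; first by rewrite addn0.
have sUY: (iter j grow W <= Y)%VS.
  by apply: contraT => /min_j; rewrite ltnn.
have: (\dim W + j <= \dim (iter j grow W))%N.
  have: forall i, (i <= j)%N ->
      (\dim W + i <= \dim (iter i grow W))%N.
    elim=> [|i IHi] lt_ij; first by rewrite addn0.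
    rewrite addnS; apply: leq_ltn_trans (IHi (ltnW lt_ij)) _.
    rewrite ltn_neqAle dimvS ?sub_grow // andbT.
    rewrite (dimv_leqif_eq (sub_grow _)).
    (* Equal consecutive terms at i <= j would give iter j.+1 = iter i. *)
    apply: contra nsUY => /eqP stat.
    suffices ->: iter j.+1 grow W = iter i grow W.
      exact: subv_trans (sub_iter_grow W (ltnW lt_ij)) sUY.
    rewrite -(subnK (leqW (ltnW lt_ij))) iterD.
    by elim: (j.+1 - i)%N => //= d ->; rewrite -stat.
  by apply.
rewrite addnS ltnS => /leq_trans; apply; apply: dimvS.
by rewrite subv_cap sUY sub_grow.
Qed.

End Growth.

(** * Rational functions on the states of an automaton *)

Section Observables.
Local Open Scope ring_scope.
Variable X : finType.
Implicit Types (a : {ffun X -> X}) (w : seq {ffun X -> X}) (S : {set X}).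

Definition observable := {ffun X -> rat^o}.
HB.instance Definition _ := Vector.on observable.
Implicit Types f : observable.

Definition pull a f : observable := [ffun x => f (a x)].
Fact pull_is_linear a : linear (pull a).
Proof. by move=> c f g; apply/ffunP=> x; rewrite !ffunE. Qed.
HB.instance Definition _ a :=
  GRing.isLinear.Build rat observable observable *:%R (pull a)
    (pull_is_linear a).

Definition pullback a : 'End(observable) := linfun (pull a).

Definition total f : rat^o := \sum_x f x.
Fact total_is_linear : linear total.
Proof.
move=> c f g; rewrite /total scaler_sumr -big_split.
by apply: eq_bigr => x _; rewrite !ffunE.
Qed.
HB.instance Definition _ :=
  GRing.isLinear.Build rat observable rat^o *:%R total total_is_linear.

Definition balanced : {vspace observable} := lker (linfun total).

Lemma balancedE f : (f \in balanced) = (\sum_x f x == 0).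
Proof. by rewrite memv_ker lfunE. Qed.

Lemma word_pullE w f x : word_lfun pullback w f x = f (word_act x w).
Proof.
elim: w x => [|a w IHw] x /=; first by rewrite id_lfunE.
by rewrite comp_lfunE lfunE ffunE IHw.
Qed.

Lemma dim_observable : \dim {:observable} = #|X|.
Proof. by rewrite dimvf /dim /= muln1. Qed.

Lemma dim_balanced : (0 < #|X|)%N -> (\dim balanced < #|X|)%N.
Proof.
move=> X_gt0; rewrite -dim_observable ltn_neqAle dimvS ?subvf // andbT.
rewrite (dimv_leqif_eq (subvf _)).
apply/eqP=> /vspaceP/(_ [ffun=> 1]); rewrite memvf balancedE.
rewrite (eq_bigr (fun=> 1)) => [|x _]; last by rewrite ffunE.
by rewrite sumr_const cardT -cardE pnatr_eq0 eqn0Ngt X_gt0.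
Qed.

Definition word_preim w S : {set X} := [set x | word_act x w \in S].

Definition deviation S : observable :=
  [ffun x => (x \in S)%:R - #|S|%:R / #|X|%:R].

Lemma sum_deviation w S : (0 < #|X|)%N ->
  \sum_x deviation S (word_act x w) = #|word_preim w S|%:R - #|S|%:R.
Proof.
move=> X_gt0; under eq_bigr do rewrite ffunE.
rewrite sumrB sumr_const -natr_sum cardT -cardE -[X in _ - X]mulr_natr.
rewrite mulfVK ?pnatr_eq0 -?lt0n //; congr (_%:R - _).
by rewrite -big_mkcond /= sum1dep_card.
Qed.

Lemma deviation_neq0 S x : (0 < #|S| < #|X|)%N -> deviation S x != 0.
Proof.
case/andP=> S_gt0 ltSX; have X_gt0 := leq_ltn_trans (leq0n _) ltSX.
have nzX: #|X|%:R != 0 :> rat by rewrite pnatr_eq0 -lt0n.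
rewrite ffunE subr_eq0; apply/eqP=> /(congr1 ( *%R^~ #|X|%:R)).
rewrite mulfVK // -natrM => /eqP; rewrite eqr_nat; case: (x \in S).
  by rewrite mul1n gtn_eqF.
by rewrite mul0n ltn_eqF.
Qed.

End Observables.

(** * Translations and the cyclotomic part of the regular representation *)

Section Translations.
Local Open Scope ring_scope.
Variable gT : finGroupType.
Implicit Types (f : observable gT) (g r : gT).

Definition translate g : 'End(observable gT) := pullback (right_translation g).

Lemma translateE g f x : translate g f x = f (x * g)%g.
Proof. by rewrite lfunE !ffunE. Qed.

Lemma iter_translateE g i f x : iter i (translate g) f x = f (x * g ^+ i)%g.
Proof.
elim: i x => [|i IHi] x; first by rewrite expg0 mulg1.
by rewrite iterS translateE IHi -mulgA -expgS.
Qed.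

Lemma translate1 : translate 1 = \1%VF.
Proof.
by apply/lfunP=> f; apply/ffunP=> x; rewrite translateE mulg1 id_lfunE.
Qed.

Lemma translateM g h : (translate g \o translate h)%VF = translate (g * h)%g.
Proof.
by apply/lfunP=> f; apply/ffunP=> x; rewrite comp_lfunE !translateE mulgA.
Qed.

Lemma observable_proper : (0 < dim (observable gT))%N.
Proof. by rewrite -dimvf dim_observable; apply/card_gt0P; exists 1%g. Qed.

(** With [T] the translation by [r] and ['X^#[r] - 1 = u * p], [p] irreducible
of degree [totient #[r]], take [psi = u(T)].  Then [p(T)] kills the image of
[psi], so that [T]-stable nonzero subspaces of this image have dimension at
least the degree of [p]. *)
Lemma cyclotomic_projection r : exists psi : 'End(observable gT),
  psi != 0 /\
  forall X : {vspace observable gT}, (translate r @: X <= X)%VS ->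
    ~~ (X <= lker psi)%VS -> (totient #[r]%g <= \dim (psi @: X))%N.
Proof.
have [p [irr_p sz_p /dvdpP[u Du]]] := rat_cyclotomic_factor (order_gt0 r).
pose act := lfun_horner (translate r) observable_proper.
have nz_up: u * p != 0 by rewrite -Du -size_poly_gt0 size_XnsubC ?order_gt0.
have [nzu nzp] : u != 0 /\ p != 0 by apply/andP; rewrite -negb_or -mulf_eq0.
have sz_u: (size u <= #[r]%g)%N.
  rewrite -ltnS -(size_XnsubC (1 : rat) (order_gt0 r)) Du size_mul //.
  by rewrite sz_p addnS /= -[leqLHS]addn0 ltn_add2l totient_gt0 order_gt0.
exists (act u); split=> [|X rX ntX].
  (* u(T) maps the Dirac function at 1 to a function whose value at r ^- i is
     the coefficient of degree i of u, as deg u < #[r]. *)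
  pose i := (size u).-1; pose delta : observable gT := [ffun x => (x == 1%g)%:R].
  have lt_i: (i < #[r]%g)%N.
    by rewrite (leq_trans _ sz_u) // prednK // size_poly_gt0.
  have -> : u = \sum_(j < #[r]%g) u`_j *: 'X^j.
    by rewrite -poly_def -[LHS](take_poly_id sz_u).
  apply/eqP=> /lfunP/(_ delta); rewrite lfun_horner_sum zero_lfunE.
  move/ffunP/(_ (r ^- i)%g); rewrite ffunE sum_ffunE.
  rewrite (bigD1 (Ordinal lt_i)) //= ffunE iter_translateE.
  rewrite ffunE mulVg eqxx big1 => [|j ne_ji].
    by rewrite addr0 -[_ *: _]/(_ * _) mulr1; apply/eqP; rewrite lead_coef_eq0.
  rewrite ffunE iter_translateE ffunE -eq_mulVg1 eq_expg_mod_order.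
  rewrite !modn_small // eq_sym; move/negPf: ne_ji; rewrite -val_eqE /= => ->.
  exact: mulr0.
have -> : totient #[r]%g = (size p).-1 by rewrite sz_p.
apply: (dim_irreducible_annihilated (T := translate r)
  (V_proper := observable_proper) irr_p).
- rewrite -limg_comp.
  have -> : (translate r \o act u)%VF = (act u \o translate r)%VF.
    by apply/lfunP=> f; rewrite !comp_lfunE lfun_horner_comm.
  by rewrite limg_comp limgS.
- by rewrite -lkerE.
move=> _ /memv_imgP[f _ ->]; rewrite -lfun_hornerM [p * u]mulrC -Du.
rewrite lfun_horner_XnsubC; apply/ffunP=> x.
by rewrite !ffunE iter_translateE expg_order mulg1 subrr.
Qed.

End Translations.

(** * Expanding a subset of the group *)

Section Expansion.
Local Open Scope ring_scope.
Variable gT : finGroupType.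
Notation pull_word := (word_lfun (@pullback gT)).

Lemma translate_balanced g (f : observable gT) :
  (translate g f \in balanced gT) = (f \in balanced gT).
Proof.
rewrite !balancedE [in RHS](reindex_inj (mulIg g)); congr (_ == 0).
by apply: eq_bigr => x _; rewrite translateE.
Qed.

(** For balanced [f] the sum over [g] of the translates of [f] is the zero
function, so the totals of their pullbacks along [u] add up to zero: if none is
positive, then all vanish. *)
Lemma average_balanced u (f : observable gT) : f \in balanced gT ->
    (forall g, \sum_x pull_word u (translate g f) x <= 0) ->
  forall g, pull_word u (translate g f) \in balanced gT.
Proof.
rewrite balancedE => /eqP f0 le0 g; rewrite balancedE -oppr_eq0; apply/eqP.
pose F g := - \sum_x pull_word u (translate g f) x.
apply: (@psumr_eq0P _ _ xpredT F) => // [h _|]; first by rewrite oppr_ge0 le0.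
rewrite /F sumrN; apply/eqP; rewrite oppr_eq0 exchange_big; apply/eqP.
apply: big1 => x _; rewrite -[RHS]f0 (reindex_inj (mulgI (word_act x u)^-1%g)).
by apply: eq_bigr => h _; rewrite word_pullE translateE mulKVg.
Qed.

Variables (Sigma : {set {ffun gT -> gT}}) (r : gT) (d : nat).
Hypothesis reach : forall g, exists2 w, word_over Sigma w /\ (size w <= d)%N
  & forall x, word_act x w = (x * g)%g.
Hypothesis le_d_phi : (d <= totient #[r]%g)%N.
Hypothesis syncSigma : synchronizing Sigma.

(** The argument is by contradiction: as long as no word of length at most
[#|gT|] expands [S], all the functions [u g w gamma] met below are balanced,
whatever [g] in the group, and the ascending chain has no room left. *)
Lemma expanding_word (S : {set gT}) : (0 < #|S| < #|gT|)%N ->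
  exists w, [/\ word_over Sigma w, (size w <= #|gT|)%N
              & (#|S| < #|word_preim w S|)%N].
Proof.
move=> S_proper.
have gT_gt0 : (0 < #|gT|)%N by apply/card_gt0P; exists 1%g.
pose gamma := deviation S; pose B := balanced gT.
case: (boolP [exists n : 'I_#|gT|.+1, [exists w : n.-tuple {ffun gT -> gT},
   all (mem Sigma) w && (#|S| < #|word_preim w S|)%N]]).
  case/existsP=> n /existsP[w /andP[/allP Sw ltSw]].
  by exists w; rewrite size_tuple -ltnS.
rewrite negb_exists => /forallP no_exp; exfalso.
have stuck w : word_over Sigma w -> (size w <= #|gT|)%N ->
    \sum_x gamma (word_act x w) <= 0.
  move=> Sw sz_w; rewrite sum_deviation // subr_le0 ler_nat leqNgt.
  have := no_exp (Ordinal (sz_w : (size w < #|gT|.+1)%N)).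
  rewrite negb_exists => /forallP/(_ (in_tuple w)) /=.
  by rewrite negb_and; case: allP => // [[]].
have word_cat u w : word_over Sigma u -> word_over Sigma w ->
    word_over Sigma (u ++ w).
  by move=> Su Sw a; rewrite mem_cat => /orP[/Su | /Sw].
have avg u w g : word_over Sigma u -> word_over Sigma w ->
    (size u + d + size w <= #|gT|)%N -> pull_word w gamma \in B ->
    pull_word u (translate g (pull_word w gamma)) \in B.
  move=> Su Sw sz_uw wB; apply: average_balanced => // h.
  have [v [Sv sz_v] act_v] := reach h.
  have Suvw := word_cat _ _ Su (word_cat _ _ Sv Sw).
  apply: le_trans (stuck _ Suvw _); last first.
    by rewrite !size_cat addnA (leq_trans _ sz_uw) // leq_add2r leq_add2l.
  rewrite le_eqVlt; apply/orP; left; apply/eqP/eq_bigr => x _.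
  by rewrite word_pullE translateE word_pullE /word_act !foldl_cat -act_v.
have gammaB: gamma \in B.
  rewrite balancedE; have := @sum_deviation _ [::] S gT_gt0.
  rewrite /= => ->; rewrite subr_eq0 eqr_nat; apply/eqP/eq_card => x.
  by rewrite inE.
have [w0 Sw0 sync0] := syncSigma.
(* Along a synchronizing word gamma pulls back to a constant, and gamma does
   not take the value 0. *)
have escape w : synchronizing_word w -> pull_word w gamma \notin B.
  move=> /eqP/cards1P[y im_y]; rewrite balancedE.
  rewrite (eq_bigr (fun=> gamma y)) => [|x _].
    rewrite sumr_const cardT -cardE mulrn_eq0 negb_or -lt0n gT_gt0 /=.
    exact: deviation_neq0.
  rewrite word_pullE; congr (gamma _); apply/set1P; rewrite -im_y.
  exact: imset_f.
have [psi [nz_psi rank_psi]] := cyclotomic_projection r.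
have dim_ker: (totient #[r]%g + \dim (lker psi) <= #|gT|)%N.
  rewrite -dim_observable -(limg_ker_dim psi fullv) capfv addnC leq_add2l.
  apply: rank_psi; first exact: subvf.
  apply: contra nz_psi => /subvP ker_all; apply/eqP/lfunP=> f.
  by rewrite zero_lfunE; apply/eqP; rewrite -memv_ker ker_all ?memvf.
(* First chain: words applied to gamma, until it leaves the balanced functions
   killed by psi. *)
pose U0 := <[gamma]>%VS; pose C := (lker psi :&: B)%VS.
have [| |j nsUC dimU] := @grow_escape _ _ _ Sigma (@pullback gT) U0 C.
- by rewrite dim_vline; case: (gamma != 0).
- exists w0 => //; apply: contra (escape _ sync0) => sub.
  have := subvP sub _ (memv_img _ (memv_line _)).
  by case/memv_capP.
set U := iter j _ _ in nsUC dimU.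
have nz_gamma: gamma != 0.
  apply: contraTneq (deviation_neq0 (1%g : gT) S_proper) => g0.
  by rewrite -/gamma g0 ffunE negbK.
have le_j: (j <= \dim (U :&: C))%N.
  by move: dimU; rewrite dim_vline nz_gamma add1n ltnS.
(* As j + d <= N, words of length j followed by a group element are still too
   short to expand S, so this chain is still balanced. *)
have le_jd: (j + d <= #|gT|)%N.
  rewrite addnC; apply: leq_trans dim_ker; apply: leq_add => //.
  by apply: leq_trans le_j _; rewrite dimvS // (subv_trans (capvSr _ _)) ?capvSl.
have UB: (U <= B)%VS.
  apply/iter_grow_subP=> w Sw sz_w; rewrite limg_line -memvE.
  have := @avg w [::] 1%g Sw; rewrite /= !id_lfunE translate1 id_lfunE.
  apply=> //; rewrite addn0; apply: leq_trans le_jd; by rewrite leq_add2r.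
have nsUpsi: ~~ (U <= lker psi)%VS.
  by apply: contra nsUC => sub; rewrite subv_cap sub.
(* Second chain: words applied to the translates of the first one.  The part of
   X in ker psi has dimension at least j, its image by psi at least phi. *)
pose X := (\sum_g translate g @: U)%VS.
have sUX: (U <= X)%VS.
  by apply: (sumv_sup 1%g) => //; rewrite translate1 lim1g.
have rX: (translate r @: X <= X)%VS.
  rewrite limg_sum; apply/subv_sumP => g _; rewrite -limg_comp translateM.
  exact: sumv_sup.
have dimX: (j + totient #[r]%g <= \dim X)%N.
  rewrite -(limg_ker_dim psi X); apply: leq_add.
    apply: leq_trans le_j _; apply: dimvS; rewrite capvA.
    by apply: subv_trans (capvSl _ _) _; apply: capvS.
  by apply: rank_psi => //; apply: contra nsUpsi; apply: subv_trans.
have shiftU u : word_over Sigma u -> (size u + d + j <= #|gT|)%N ->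
   (pull_word u @: X <= B)%VS.
  move=> Su sz_u; rewrite limg_sum; apply/subv_sumP => g _.
  have : (U <= (pull_word u \o translate g) @^-1: B)%VS.
    apply/iter_grow_subP => w Sw sz_w; rewrite limg_line -memvE -memv_preim.
    rewrite comp_lfunE; apply: avg => //.
      by apply: leq_trans sz_u; rewrite leq_add2l.
    apply: (subvP UB); apply: (subvP _ _ (memv_img _ (memv_line _))).
    by move/iter_grow_subP: (subvv U); apply.
  move=> sub; rewrite -limg_comp; apply/subvP=> _ /memv_imgP[f Uf ->].
  by rewrite memv_preim (subvP sub).
have XB: (X <= B)%VS.
  apply/subv_sumP => g _; apply/subvP=> _ /memv_imgP[f Uf ->].
  by rewrite translate_balanced (subvP UB).
(* The dimension of the balanced space gives i + j + phi <= N for the exit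
   index i, but no word of such a length can leave it. *)
have [| |i nsXB dimXi] := @grow_escape _ _ _ Sigma (@pullback gT) X B.
- by rewrite (capv_idPl XB).
- exists w0 => //; apply: contra (escape _ sync0) => /subvP; apply.
  apply: memv_img; apply: (subvP sUX).
  by apply: (subvP (sub_iter_grow _ _ _ (leq0n j))); apply: memv_line.
case/negP: nsXB; apply/iter_grow_subP=> u Su sz_u.
apply: (shiftU u) => //.
have ltB Z := leq_ltn_trans (dimvS (capvSr Z B)) (dim_balanced gT_gt0).
have := leq_trans dimXi (ltB _).
apply: leq_trans; apply: leq_trans (leq_add dimX sz_u).
by rewrite addnC [X in (_ <= X)%N]addnC addnCA leq_add2l leq_add2l.
Qed.

End Expansion.

(** * Synchronizing words when the diameter is at most a totient *)

Section Cerny.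

Lemma merging_letter (X : finType) (Sigma : {set {ffun X -> X}}) :
    1 < #|X| -> synchronizing Sigma ->
  exists2 a, a \in Sigma & exists y, 1 < #|word_preim [:: a] [set y]|.
Proof.
move=> X_gt1 [w Sw sync_w].
case: (boolP [exists a in Sigma, ~~ injectiveb a]) => [|inj].
  case/exists_inP=> a Sa /injectivePn[x [x' ne_x eq_ax]]; exists a => //.
  exists (a x); rewrite (cardD1 x) (cardD1 x') !inE /= eq_sym ne_x.
  by rewrite -eq_ax !eqxx.
suffices inj_w: injective (fun x => word_act x w).
  have: #|[set word_act x w | x : X]| = #|X| by apply: card_imset.
  by rewrite sync_w => X1; rewrite -X1 in X_gt1.
rewrite negb_exists_in in inj; move/forall_inP: inj => inj {sync_w}.
elim: w Sw => [|a w IHw] Sw x y //= eq_xy.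
have Sa: a \in Sigma by apply: Sw; rewrite mem_head.
have/negPn/injectiveP inj_a := inj a Sa.
apply: inj_a; apply: IHw eq_xy => b wb; apply: Sw; by rewrite inE wb orbT.
Qed.

(** The argument in terms of preimages of a point [y]: a letter merging two
points starts with a preimage of at least two points, and each further element
costs at most [#|gT|] letters. *)
Theorem cerny_of_diameter_le_totient (gT : finGroupType) (Delta : {set gT})
    (r : gT) (d : nat) :
    <<Delta>>%g = [set: gT] ->
    (forall g, exists2 w, word_over (cayley_automaton Delta) w /\ size w <= d
       & forall x, word_act x w = (x * g)%g) ->
    d <= totient #[r]%g ->
  cerny_cayley_graph Delta.
Proof.
move=> genD reachD le_d; split=> // Sigma /subsetP sDS syncS.
have reach g : exists2 w, word_over Sigma w /\ size w <= d
   & forall x, word_act x w = (x * g)%g.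
  have [w [Dw sz_w] act_w] := reachD g; exists w => //; split=> // a /Dw.
  exact: sDS.
have [gT_le1 | gT_gt1] := leqP #|gT| 1.
  exists [::]; split=> //; apply/eqP.
  rewrite eqn_leq (leq_trans (leq_imset_card _ _)) //=.
  by apply/card_gt0P; exists (word_act 1%g [::]); apply: imset_f.
have [a Sa [y y_gt1]] := merging_letter gT_gt1 syncS.
have grow_preim k : k.+2 <= #|gT| -> exists w,
    [/\ word_over Sigma w, size w <= 1 + k * #|gT|
      & k.+2 <= #|word_preim w [set y]|].
  elim: k => [|k IHk] lt_k.
    by exists [:: a]; split=> // b; rewrite inE => /eqP->.
  have [w [Sw sz_w ge_w]] := IHk (ltnW lt_k).
  have [gt_w | le_w] := ltnP k.+2 #|word_preim w [set y]|.
    by exists w; split=> //; rewrite (leq_trans sz_w) // mulSn; lia.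
  have [|v [Sv sz_v lt_v]] :=
    expanding_word reach le_d syncS (S := word_preim w [set y]).
    by rewrite (leq_ltn_trans le_w lt_k) andbT; apply: leq_trans ge_w.
  exists (v ++ w); split.
  - by move=> b; rewrite mem_cat => /orP[/Sv | /Sw].
  - by rewrite size_cat; move: sz_v sz_w; rewrite mulSn; lia.
  have -> : word_preim (v ++ w) [set y] = word_preim v (word_preim w [set y]).
    by apply/setP=> x; rewrite !inE /word_act foldl_cat.
  exact: leq_ltn_trans ge_w lt_v.
have [|w [Sw sz_w ge_w]] := grow_preim #|gT|.-2; first by lia.
exists w; split=> //; last first.
  by apply: leq_trans sz_w _; move: gT_gt1; case: #|gT| => [|[|N]] // _; nia.
have preim_w: word_preim w [set y] = setT.
  apply/eqP; rewrite eqEcard subsetT cardsT (leq_trans _ ge_w) //.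
  by move: gT_gt1; case: #|gT| => [|[|N]].
apply/eqP/cards1P; exists y; apply/eqP; rewrite eqEsubset.
apply/andP; split.
  by apply/subsetP=> _ /imsetP[x _ ->]; move/setP/(_ x): preim_w; rewrite !inE.
rewrite sub1set; apply/imsetP; exists 1%g => //.
by move/setP/(_ 1%g): preim_w; rewrite !inE => /eqP.
Qed.

End Cerny.

(** * Word lengths in dihedral groups *)

Section Dihedral.
Local Open Scope group_scope.

(** Every element outside [<[x]>] has the form [x ^+ i * y] and is an
involution inverting [x].  As [n] is odd, [r] is not one of them, so
[<[r]> = <[x]>]. *)
Lemma dihedral_structure (gT : finGroupType) n (s r : gT) :
    1 < n -> odd n -> #|[set: gT]| = n.*2 ->
    [set: gT] \homg Grp (x : y : x ^+ n, y ^+ 2, x ^ y = x^-1) ->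
    #[r] = n -> s \notin <[r]> ->
  [/\ s ^+ 2 = 1, r ^ s = r^-1 & forall g, (g \in <[r]>) || (s * g \in <[r]>)].
Proof.
move=> n_gt1 odd_n cardD /existsP[[x y] /= /eqP[gen xn y2 xy]] or r's.
have x_yx : x * y = y * x^-1 by rewrite -xy conjgC.
have nxy : <[y]> \subset 'N(<[x]>).
  by rewrite norms_cycle xy groupV cycle_id.
have ox : #[x] = n.
  apply/eqP; rewrite eqn_leq dvdn_leq ?(ltnW n_gt1) ?order_dvdn ?xn //=.
  have oy : #[y] <= 2 by rewrite dvdn_leq // order_dvdn y2.
  have le_xy : n.*2 <= #[x] * #[y].
    by rewrite /order mul_cardG -norm_joinEr // gen cardD leq_pmulr ?cardG_gt0.
  by rewrite -leq_double (leq_trans le_xy) // -muln2 leq_mul2l oy orbT.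
have coset g : g \notin <[x]> -> exists i, g = x ^+ i * y.
  have : g \in <[x]> <*> <[y]> by rewrite gen inE.
  rewrite norm_joinEr // => /mulsgP[_ _ /cycleP[i ->] /cycleP[j ->] ->].
  rewrite -(expg_mod j y2) modn2; case: (odd j); first by exists i.
  by rewrite mulg1 mem_cycle.
have cinv i : x ^+ i * y = y * x ^- i.
  by rewrite conjgC conjXg xy expgVn.
have mul_refl i k : x ^+ i * y * (x ^+ k * y) = x ^+ i * x ^- k.
  by rewrite [x ^+ k * y]cinv mulgA -[_ * y * y]mulgA -expg2 y2 mulg1.
have r_x : r \in <[x]>.
  apply: contraT => /coset[i def_r].
  have : n %| 2 by rewrite -or order_dvdn expg2 def_r mul_refl mulgV.
  by move/(dvdn_leq (ltn0Sn 1)) => n_le2; move: odd_n; lia.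
have eq_cyc : <[r]> = <[x]>.
  by apply/eqP; rewrite eqEcard cycle_subG r_x -!orderE or ox leqnn.
have s'x : s \notin <[x]>.
  by rewrite -eq_cyc.
have [i def_s] := coset s s'x.
split; first by rewrite expg2 def_s mul_refl mulgV.
  have /cycleP[k ->] := r_x.
  rewrite def_s conjgM (conjgE _ (x ^+ i)) -expgD addnC expgD mulKg.
  by rewrite conjXg xy expgVn.
move=> g; rewrite eq_cyc; case: (boolP (g \in <[x]>)) => //= /coset[k ->].
by rewrite def_s mul_refl groupM ?groupV ?mem_cycle.
Qed.


Lemma act_nseq (gT : finGroupType) (g x : gT) k :
  word_act x (nseq k (right_translation g)) = x * g ^+ k.
Proof.
elim: k x => [|k IHk] x; first by rewrite mulg1.
by rewrite /= -/(word_act _ _) IHk ffunE -mulgA -expgS.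
Qed.

(** For [0 <= j < n], [r ^+ j] is itself a word of length [j]
and, as [s] inverts [r], equals [s * r ^+ (n - j) * s]; likewise [s * r ^+ j] is
a word of length [j + 1] and equals [r ^+ (n - j) * s].  In each case one of the
two lengths is at most [(n + 1) / 2]. *)
Lemma dihedral_diameter (gT : finGroupType) n (s r : gT) :
    odd n -> s ^+ 2 = 1 -> r ^ s = r^-1 -> #[r] = n ->
    (forall g, (g \in <[r]>) || (s * g \in <[r]>)) ->
  forall g, exists2 w,
    word_over (cayley_automaton [set r; s]) w /\ size w <= n./2.+1
    & forall x, word_act x w = x * g.
Proof.
move=> odd_n s2 rs or half g.
pose R := right_translation r; pose S := right_translation s.
have Ra : R \in cayley_automaton [set r; s] by rewrite imset_f ?set21.
have Sa : S \in cayley_automaton [set r; s] by rewrite imset_f ?set22.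
have over k b c : word_over (cayley_automaton [set r; s])
    (nseq b S ++ nseq k R ++ nseq c S).
  by move=> a; rewrite !mem_cat !mem_nseq => /or3P[] /andP[_ /eqP->].
have act x b k c : word_act x (nseq b S ++ nseq k R ++ nseq c S)
    = x * (s ^+ b * r ^+ k * s ^+ c).
  by rewrite /word_act !foldl_cat -!/(word_act _ _) !act_nseq !mulgA.
have witness b k c : g = s ^+ b * r ^+ k * s ^+ c -> b + k + c <= n./2.+1 ->
    exists2 w, word_over (cayley_automaton [set r; s]) w /\ size w <= n./2.+1
    & forall x, word_act x w = x * g.
  move=> -> le_bkc; exists (nseq b S ++ nseq k R ++ nseq c S) => //.
  by split=> //; rewrite !size_cat !size_nseq addnA.
have ss h : s * (s * h) = h by rewrite mulgA -expg2 s2 mul1g.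
have flip k : k <= n -> s * r ^+ (n - k) * s = r ^+ k.
  move=> le_kn; have -> : r ^+ k = (r ^+ (n - k)) ^ s.
    rewrite conjXg rs expgVn; apply/eqP; rewrite eq_sym eq_invg_mul -expgD.
    by rewrite subnK // -or expg_order.
  have sV : s^-1 = s by apply/eqP; rewrite eq_invg_mul -expg2 s2.
  by rewrite conjgE sV mulgA.
have mod_n k : r ^+ (k %% n) = r ^+ k by rewrite expg_mod // -or expg_order.
have n_gt0 : 0 < n by rewrite -or order_gt0.
case/orP: (half g) => /cycleP[j0]; rewrite -mod_n.
all: have := ltn_pmod j0 n_gt0; move: (j0 %% n) => j lt_j def_g.
- have [le_j | gt_j] := leqP j n./2.+1.
    by apply: (witness 0%N j 0%N); rewrite ?mul1g ?mulg1 ?addn0.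
  apply: (witness 1%N (n - j) 1%N); first by rewrite expg1 flip // ltnW.
  by move: odd_n; lia.
have {def_g} def_g : g = s * r ^+ j by rewrite -def_g ss.
have [le_j | gt_j] := leqP j n./2.
  by apply: (witness 1%N j 0%N); rewrite ?expg1 ?mulg1 ?addn0.
apply: (witness 0%N (n - j) 1%N).
  by rewrite mul1g def_g -(flip j) ?(ltnW lt_j) // -mulgA ss.
by move: odd_n; lia.
Qed.

End Dihedral.

(** * Euler's totient at odd numbers with at most two prime factors *)

Lemma totient_lb_prime_power p k : prime p -> odd p -> 0 < k ->
  2 * p ^ k <= 3 * totient (p ^ k).
Proof.
move=> p_pr odd_p k_gt0; rewrite totient_pfactor // -{1}(prednK k_gt0) expnS.
by rewrite !mulnA leq_mul2r; have := prime_gt1 p_pr; move: odd_p; lia.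
Qed.

Lemma half_le_totient n :
    (exists p k : nat, [/\ prime p, odd p, 1 <= k & n = p ^ k]) \/
    (exists p q k l : nat, [/\ prime p /\ odd p, prime q /\ odd q, p < q,
                               1 <= k /\ 1 <= l & n = p ^ k * q ^ l]) ->
  [/\ odd n, 1 < n & n./2.+1 <= totient n].
Proof.
case=> [[p [k [p_pr odd_p k_gt0 ->]]] |
        [p [q [k [l [[p_pr odd_p] [q_pr odd_q] ltpq [k_gt0 l_gt0] ->]]]]]].
  have phi := totient_lb_prime_power p_pr odd_p k_gt0.
  have odd_n : odd (p ^ k) by rewrite oddX odd_p orbT.
  have p_gt2 := odd_prime_gt2 odd_p p_pr.
  have n_ge : p <= p ^ k by rewrite -{1}(expn1 p) leq_exp2l ?prime_gt1.
  by split=> //; move: odd_n; lia.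
have odd_n : odd (p ^ k * q ^ l) by rewrite oddM !oddX odd_p odd_q !orbT.
have p_gt2 := odd_prime_gt2 odd_p p_pr.
have q_gt4 : 4 < q by move: odd_q; lia.
have n_ge : p * q <= p ^ k * q ^ l.
  rewrite leq_mul //.
    by rewrite -{1}(expn1 p) leq_exp2l ?prime_gt1.
  by rewrite -{1}(expn1 q) leq_exp2l ?prime_gt1.
have phi_p := totient_lb_prime_power p_pr odd_p k_gt0.
(* q >= 5, so the quotient of totient (q ^ l) by q ^ l is at least 4/5. *)
have phi_q : 4 * q ^ l <= 5 * totient (q ^ l).
  rewrite totient_pfactor // -{1}(prednK l_gt0) expnS.
  by rewrite !mulnA leq_mul2r; lia.
have phi : totient (p ^ k * q ^ l) = (totient (p ^ k) * totient (q ^ l))%N.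
  rewrite totient_coprime // coprimeXl // coprimeXr // prime_coprime //.
  by rewrite dvdn_prime2 // ltn_eqF.
have ge_pq : 15 <= p * q by rewrite (leq_mul p_gt2 q_gt4).
have := leq_mul phi_p phi_q.
(* From 8 n <= 15 phi and n >= 15, n odd, follows n + 1 <= 2 phi. *)
rewrite phi; split=> //; first by lia.
move: odd_n; nia.
Qed.

(** * The Cayley graph of the dihedral group *)

Theorem mainTheorem7 (n : nat)
  (hn : (exists p k : nat,
           [/\ prime p, odd p, 1 <= k & n = p ^ k]) \/
        (exists p q k l : nat,
           [/\ prime p /\ odd p, prime q /\ odd q, p < q,
               1 <= k /\ 1 <= l & n = p ^ k * q ^ l]))
  (s r : 'D_(n.*2))
  (hs : is_reflection s) (hr : is_rotation r) (hrn : #[r]%g = n) :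
  cerny_cayley_graph [set r; s].
Proof.
have [odd_n n_gt1 le_phi] := half_le_totient hn.
have r's : s \notin <[r]>%g.
  apply/negP=> rs; case: hs; exists <[r]>%G.
  by rewrite cycle_cyclic -orderE.
have [s2 rs half] := dihedral_structure n_gt1 odd_n (card_dihedral n_gt1)
  (isoGrp_hom (Grp_dihedral n_gt1)) hrn r's.
have diam := dihedral_diameter odd_n s2 rs hrn half.
apply: (cerny_of_diameter_le_totient (r := r)) diam _; last by rewrite hrn.
apply/setP=> g; rewrite inE; set G := (X in g \in X).
have Gr : r \in G by rewrite mem_gen ?set21.
have Gs : s \in G by rewrite mem_gen ?set22.
have sub h : h \in <[r]>%g -> h \in G by apply/subsetP; rewrite cycle_subG.
by case/orP: (half g) => /sub //; rewrite groupMl.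
Qed.
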